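(* Let $M\subset\mathbb{R}^d$ be a compact set which is intervally thin in $d$ linearly independent directions $n_1,\dots,n_d\in S^{d-1}$. Suppose that $M$ has $\sigma$-finite $(d-1)$-dimensional Hausdorff measure. Then $M$ is $c$-removable.
   Context: $B(x,\varepsilon)$ is the open Euclidean ball with centre $x$ and radius $\varepsilon$; $[x,y]$ is the line segment with endpoints $x,y\in\mathbb{R}^d$; $S^{d-1}$ is the unit sphere in $\mathbb{R}^d$. A set $A\subset\mathbb{R}^d$ is intervally thin in direction $v\in S^{d-1}$ if for any $x,y\in\mathbb{R}^d$ with $x-y$ parallel to $v$, and any $\varepsilon>0$, there exist $x'\in B(x,\varepsilon)$ and $y'\in B(y,\varepsilon)$ such that $[x',y']\cap A=\emptyset$. For $U\subset\mathbb{R}^d$ open, a function $f:U\to\mathbb{R}$ is locally convex on $U$ if every point of $U$ has an open convex neighbourhood $V\subset U$ such that $f|_V$ is convex. A closed set $A\subset\mathbb{R}^d$ is $c$-removable if every function $f:\mathbb{R}^d\to\mathbb{R}$ which is continuous on $\mathbb{R}^d$ and locally convex on $\mathbb{R}^d\setminus A$ is convex on $\mathbb{R}^d$. *)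

(* Defs.v *)
(* Points of R^d are row vectors 'rV[R]_d over an arbitrary realType R. *)
From mathcomp Require Import all_boot all_order all_algebra.
From mathcomp Require Import all_classical all_reals all_analysis.

Set Implicit Arguments.
Unset Strict Implicit.
Unset Printing Implicit Defensive.

Import Order.TTheory GRing.Theory Num.Theory.
Import numFieldNormedType.Exports.

Local Open Scope classical_set_scope.
Local Open Scope ring_scope.

(* The norm `|x| of the library on 'rV[R]_d is the sup norm.  It induces the
   usual topology, so open, closed, compact and continuous are used as they
   are, but balls, the sphere and diameters need the Euclidean norm. *)
Definition enorm (R : realType) (d : nat) (x : 'rV[R]_d) : R :=
  Num.sqrt (\sum_(i < d) x ord0 i ^+ 2).

Definition eball (R : realType) (d : nat) (x : 'rV[R]_d) (e : R) :
    set 'rV[R]_d :=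
  [set y | enorm (y - x) < e].

Definition esphere (R : realType) (d : nat) : set 'rV[R]_d :=
  [set v | enorm v = 1].

Definition segment (R : realType) (d : nat) (x y : 'rV[R]_d) :
    set 'rV[R]_d :=
  [set (1 - t) *: x + t *: y | t in [set t : R | 0 <= t <= 1]].

Definition intervally_thin (R : realType) (d : nat) (A : set 'rV[R]_d)
    (v : 'rV[R]_d) : Prop :=
  forall x y : 'rV[R]_d, (exists t : R, x - y = t *: v) ->
  forall e : R, 0 < e ->
  exists x' y' : 'rV[R]_d,
    [/\ eball x e x', eball y e y' & segment x' y' `&` A = set0].

(* f is total, but only its values on U matter. *)
Definition locally_convex_on (R : realType) (d : nat) (U : set 'rV[R]_d)
    (f : 'rV[R]_d -> R) : Prop :=
  forall x, U x ->
  exists V : set 'rV[R]_d,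
    [/\ open V, V x, convex_set V, V `<=` U & convex_function V f].

Definition c_removable (R : realType) (d : nat) (A : set 'rV[R]_d) : Prop :=
  closed A /\
  forall f : 'rV[R]_d -> R, continuous f -> locally_convex_on (~` A) f ->
    convex_function [set: 'rV[R]_d] f.

(* Adding 0 to the set of distances only serves to make the diameter of the
   empty set 0 instead of -oo. *)
Definition ediam (R : realType) (d : nat) (A : set 'rV[R]_d) : \bar R :=
  ereal_sup (0%E |` [set (enorm (p.1 - p.2))%:E | p in A `*` A]).

(* The contribution diam(A)^m of a covering set, with the convention that the
   empty set contributes 0 and a singleton contributes 0^0 = 1 when m = 0, so
   that the 0-dimensional Hausdorff measure is the counting measure. *)
Definition hausdorff_gauge (R : realType) (d m : nat) (A : set 'rV[R]_d) :
    \bar R :=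
  if A == set0 then (0 : \bar R)%E else (ediam A ^+ m)%E.

Definition hausdorff_content (R : realType) (d m : nat) (delta : R)
    (A : set 'rV[R]_d) : \bar R :=
  ereal_inf [set (\sum_(0 <= i <oo) hausdorff_gauge m (U i))%E
            | U in [set U : (set 'rV[R]_d)^nat |
                     A `<=` \bigcup_i U i /\
                     forall i, (ediam (U i) <= delta%:E)%E]].

(* The m-dimensional Hausdorff (outer) measure, without the normalising
   constant relating it to Lebesgue measure, which is irrelevant for
   finiteness. *)
Definition hausdorff_measure (R : realType) (d m : nat) (A : set 'rV[R]_d) :
    \bar R :=
  ereal_sup [set hausdorff_content m delta A
            | delta in [set delta : R | 0 < delta]].

(* The pieces are not required to be measurable; since Hausdorff measure is
   Borel regular, requiring it would not change the notion for a closed A. *)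
Definition sigma_finite_hausdorff (R : realType) (d m : nat)
    (A : set 'rV[R]_d) : Prop :=
  exists2 F : (set 'rV[R]_d)^nat,
    A = \bigcup_i F i & forall i, (hausdorff_measure m (F i) < +oo)%E.

(* Main.v *)
Require Import Defs.
From mathcomp Require Import all_boot all_order all_algebra.
From mathcomp Require Import all_classical all_reals all_analysis.
From mathcomp Require Import measurable_realfun ring lra.

Import Order.TTheory GRing.Theory Num.Theory.
Import numFieldNormedType.Exports.

Local Open Scope classical_set_scope.
Local Open Scope ring_scope.

Set Implicit Arguments.
Unset Strict Implicit.
Unset Printing Implicit Defensive.

(** Call f convex along v when its restriction to every line of direction v is
    convex.  The proof shows that f is convex along every vector.

    Thinness gives the directions n_i.  A segment parallel to n_i is a limit of
    segments that miss M; f is convex on these, being locally convex near them,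
    and continuity passes the inequality to the limit ([thin_convex_along]).

    The vectors along which f is convex are closed under scaling, and the heart
    of the proof is that they are closed under addition ([convex_along_add]);
    since the n_i form a basis, the theorem follows.  So let f be convex along u
    and w, and not along v = u + w.

    - If f fails to be convex on a line of direction v, then for every slope c
      in some open interval the function f - c s has an interior maximum on a
      segment of that line, and the leftmost maximum point lies on M, as f is
      not locally convex there ([line_contact]).  The same interval of slopes
      serves for all nearby parallel lines.
    - If such a line meets M in a countable set only, two slopes q < q' share a
      maximum point: there f has a concave kink along v, quantified by q and q'.
    - In a plane spanned by v and w, index the lines of direction v by the
      coordinate tau along w.  For rational q < q' fixed, only countably many tau
      carry a kink.  Indeed, let (tau, h) be a kink, and compare it with kinks
      on a line before and a line after.  Convexity along w bounds f(tau, h) by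
      the values on these lines at height h, convexity along u by the values
      at heights sheared by the distances of the lines.  As the kinks cannot sit
      at both heights, one of the two inequalities gains; so the kink values,
      as a function of tau, have chord slopes that jump by a fixed amount at
      each kink ([kink_slope_gap]), which leaves room for countably many only
      ([slope_gap_countable]).
    - Hence, in every such plane close to the given line, all but countably many
      of the lines near it meet M in an uncountable set.  But M has sigma-finite
      (d-1)-dimensional measure, so by a Fubini argument some plane arbitrarily
      close to the given line has almost all of its lines meeting M in a
      countable set ([countable_fibres]).

    The shear argument replaces any rectifiability or differentiability
    statement, and it works in planes, so that Lebesgue measure enters on the
    real line only. *)

(** * Lower limits of covering sums and their sections *)

(** Fatou's lemma, read as an almost everywhere statement. *)
Lemma limn_einf_lt_pinfty_ae (dp : measure_display) (T : measurableType dp)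
    (R : realType) (mu : {measure set T -> \bar R}) (F : nat -> T -> \bar R) :
  (forall k, measurable_fun setT (F k)) -> (forall k z, (0 <= F k z)%E) ->
  (limn_einf (fun k => \int[mu]_(z in setT) F k z) < +oo)%E ->
  {ae mu, forall z, (limn_einf (F^~ z) < +oo)%E}.
Proof.
move=> mF F0 lim_lt.
set L := fun z => limn_einf (F^~ z).
have L0 z : (0 <= L z)%E.
  rewrite /L limn_einf_lim; apply: lime_ge; first exact: is_cvg_einfs.
  by apply: nearW => k; apply: le_ereal_inf_tmp => _ [j _ <-].
have mL : measurable_fun setT L.
  rewrite /L /limn_einf; apply: measurableT_comp => //.
  apply: measurable_fun_limn_esup => k.
  exact: measurableT_comp.
have iL : (\int[mu]_(z in setT) L z < +oo)%E.
  apply: le_lt_trans lim_lt; apply: fatou => //.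
have Lint : mu.-integrable setT L.
  apply/integrableP; split => //.
  by under eq_integral => z _ do rewrite gee0_abs//.
apply: filterS (integrable_ae measurableT Lint) => z /(_ I) /=.
by rewrite ge0_fin_numE.
Qed.

(** One step of the Fubini argument.  By Fatou, the lower limit of the sections
    of the weighted sums of intervals is integrable, hence finite almost
    everywhere; the countably many indices n are treated at once, and a
    countable set D can be avoided because it is negligible too. *)
Lemma exists_section_liminf_finite (R : realType) (w r a : nat -> nat -> nat -> R)
    (D : set R) (e : R) : 0 < e -> countable D ->
  (forall n k i, 0 <= w n k i) -> (forall n k i, 0 <= r n k i) ->
  (forall n, limn_einf (fun k =>
     \sum_(0 <= i <oo) (w n k i * (r n k i *+ 2))%:E) < +oo)%E ->
  exists z, [/\ `|z| < e, ~ D z & forall n, (limn_einf (fun k =>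
     \sum_(0 <= i <oo) (w n k i * (`|z - a n k i| <= r n k i)%R%:R)%:E)
       < +oo)%E].
Proof.
move=> e0 cD w0 r0 fin.
pose B n k i := `[a n k i - r n k i, a n k i + r n k i]%classic : set R.
pose F n k (z : R) := (\sum_(0 <= i <oo) (w n k i)%:E * (\1_(B n k i) z)%:E)%E.
have BE n k i z : \1_(B n k i) z = (`|z - a n k i| <= r n k i)%R%:R :> R.
  rewrite indicE; congr (nat_of_bool _)%:R; rewrite ler_distl.
  by apply/idP/idP; rewrite inE /B /= in_itv.
have w0' n k i z : (0 <= (w n k i)%:E * (\1_(B n k i) z)%:E)%E.
  by rewrite mule_ge0// lee_fin// BE ler0n.
have mB n k i : measurable_fun setT (fun z => (w n k i)%:E * (\1_(B n k i) z)%:E)%E.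
  apply: emeasurable_funM => //.
  by apply/measurable_EFinP; apply: measurable_indic; exact: measurable_itv.
have mF n k : measurable_fun setT (F n k).
  apply: (@ge0_emeasurable_sum _ _ _ setT
    (fun i z => (w n k i)%:E * (\1_(B n k i) z)%:E)%E predT) => [i z _ _|i _].
    exact: w0'.
  exact: mB.
have F0 n k z : (0 <= F n k z)%E by apply: nneseries_ge0.
have ae n : {ae lebesgue_measure, forall z, (limn_einf (F n ^~ z) < +oo)%E}.
  apply: limn_einf_lt_pinfty_ae; [exact: mF|exact: F0|].
  apply: le_lt_trans (fin n).
  rewrite le_eqVlt; apply/orP; left; apply/eqP; congr limn_einf.
  apply/funext => k; rewrite integral_nneseries//; last exact: mB.
  apply: eq_eseriesr => i _.
  rewrite ge0_integralZl//; last by rewrite lee_fin.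
  2: by apply/measurable_EFinP; apply: measurable_indic; exact: measurable_itv.
  rewrite integral_indic//; last exact: measurable_itv.
  rewrite setIT EFinM; congr (_ * _)%E.
  have := lebesgue_measure_itv `[a n k i - r n k i, a n k i + r n k i].
  rewrite /= lte_fin => Bm; transitivity (lebesgue_measure (B n k i)) => //.
  rewrite Bm.
  case: ifPn => [_|]; first by rewrite -EFinB; congr EFin; ring.
  rewrite -leNgt => h.
  suff -> : r n k i = 0 by rewrite mul0rn.
  by have := r0 n k i; lra.
apply: contrapT => no.
have : lebesgue_measure.-negligible `]-e, e[%classic.
  apply: (@negligibleS _ _ _ (@lebesgue_measure R)
     (D `|` \bigcup_n [set z | ~ (limn_einf (F n ^~ z) < +oo)%E])).
    move=> z /=; rewrite in_itv/= => zI.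
    apply: contrapT => /not_orP[nD nU]; apply: no; exists z; split => //.
      by rewrite ltr_norml.
    move=> n; apply: contrapT => h; apply: nU; exists n => //= h'; apply: h.
    apply: le_lt_trans h'; rewrite le_eqVlt; apply/orP; left; apply/eqP.
    congr limn_einf; apply/funext => k; apply: eq_eseriesr => i _.
    by rewrite -BE EFinM.
  apply: negligibleU.
    apply/negligibleP; last exact: countable_lebesgue_measure0.
    exact: countable_measurable.
  by apply: negligible_bigcup => n; exact: ae.
move/negligibleP => /(_ (measurable_itv _)) m0.
have := lebesgue_measure_itv `]-e, e[; rewrite m0 /= lte_fin gtrN//.
by rewrite -EFinB => -[]; lra.
Qed.

(** Iterating the one-dimensional statement over m coordinates trades each factor
    length of a side of a cube for the indicator function of that side, without
    any measure on the product space. *)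
Lemma exists_point_liminf_finite (R : realType) (m : nat) (e : R) : 0 < e ->
  forall (w r : nat -> nat -> nat -> R) (a : nat -> nat -> nat -> nat -> R),
  (forall n k i, 0 <= w n k i) -> (forall n k i, 0 <= r n k i) ->
  (forall n, limn_einf (fun k =>
     \sum_(0 <= i <oo) (w n k i * (r n k i *+ 2) ^+ m)%:E) < +oo)%E ->
  exists z : nat -> R, (forall j, `|z j| < e) /\
   forall n, (limn_einf (fun k =>
     \sum_(0 <= i <oo) (w n k i *
        \prod_(j < m) (`|z j - a n k i j| <= r n k i)%R%:R)%:E) < +oo)%E.
Proof.
move=> e0; elim: m => [|m IH] w r a w0 r0 fin.
  exists (fun=> 0); split=> [j|n]; first by rewrite normr0.
  apply: le_lt_trans (fin n); rewrite le_eqVlt; apply/orP; left; apply/eqP.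
  by congr limn_einf; apply/funext => k; apply: eq_eseriesr => i _; rewrite big_ord0.
have [|||z [zs zfin]] := IH (fun n k i => w n k i * (r n k i *+ 2)) r a => //.
- by move=> n k i; rewrite mulr_ge0// mulrn_wge0.
- move=> n; apply: le_lt_trans (fin n); rewrite le_eqVlt; apply/orP; left; apply/eqP.
  congr limn_einf; apply/funext => k; apply: eq_eseriesr => i _.
  by rewrite exprS mulrA.
have [||||x [xs _ xfin]] := @exists_section_liminf_finite R (fun n k i =>
    w n k i * \prod_(j < m) (`|z j - a n k i j| <= r n k i)%R%:R) r
    (fun n k i => a n k i m) set0 e e0 => //.
- by move=> n k i; rewrite mulr_ge0// prodr_ge0.
- move=> n; apply: le_lt_trans (zfin n).
  rewrite le_eqVlt; apply/orP; left; apply/eqP.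
  congr limn_einf; apply/funext => k; apply: eq_eseriesr => i _.
  by rewrite mulrAC.
exists (fun j => if (j < m)%N then z j else x); split.
  by move=> j; case: ifP.
move=> n; apply: le_lt_trans (xfin n).
rewrite le_eqVlt; apply/orP; left; apply/eqP.
congr limn_einf; apply/funext => k; apply: eq_eseriesr => i _.
rewrite big_ord_recr/= ltnn mulrA; congr ((_ * _ * _)%:E).
by apply: eq_bigr => j _; rewrite ltn_ord.
Qed.

Lemma limn_einf_lt_pinftyP (R : realType) (u : nat -> \bar R) :
  (limn_einf u < +oo)%E ->
  exists K : nat, forall k0, exists2 k, (k0 <= k)%N & (u k < K%:R%:E)%E.
Proof.
move=> uoo.
have [K uK] : exists K : nat, (limn_einf u < K%:R%:E)%E.
  case: (limn_einf u) uoo => [x _||_] //.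
    by exists (Num.truncn x).+1; rewrite lte_fin truncnS_gt.
  by exists 0%N; rewrite ltNyr.
exists K => k0.
have : (einfs u k0 < K%:R%:E)%E.
  apply: le_lt_trans uK; rewrite limn_einf_lim.
  rewrite (cvg_lim _ (@cvg_einfs_sup _ u))//.
  by apply: ereal_sup_ubound; exists k0.
by move=> /ereal_inf_lt[_ /= [k k0k <-] ukK]; exists k.
Qed.

Lemma limn_einf_bounded (R : realType) (u : nat -> \bar R) (C : R) :
  (forall k, (u k <= C%:E)%E) -> (limn_einf u < +oo)%E.
Proof.
move=> uC; apply: (@le_lt_trans _ _ C%:E); last exact: ltry.
rewrite limn_einf_lim; apply: lime_le; first exact: is_cvg_einfs.
apply: nearW => k; apply: le_trans (uC k).
by apply: ereal_inf_lbound; exists k => /=.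
Qed.

Lemma sum_seq_le_nneseries (R : realType) (u : nat -> \bar R) (s : seq nat) :
  (forall i, (0 <= u i)%E) -> uniq s ->
  (\sum_(i <- s) u i <= \sum_(0 <= i <oo) u i)%E.
Proof.
move=> u0 us; pose N := (\max_(i <- s) i).+1.
apply: (le_trans _ (@nneseries_lim_ge _ u predT 0 N (fun i _ _ => u0 i))).
rewrite (perm_big [seq i <- index_iota 0 N | i \in s]); last first.
  apply: uniq_perm => //; first by rewrite filter_uniq// iota_uniq.
  move=> i; rewrite mem_filter mem_index_iota/=.
  case: (boolP (i \in s)) => //= si; rewrite /N ltnS.
  by apply/esym; exact: (leq_bigmax_seq i si isT).
rewrite big_filter; apply: lee_sum_nneg_subset => //.
Qed.

(** Let K exceed the lower limit.  If S had K points, then at every fine enough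
    scale they would lie in K different members of the cover, each contributing
    at least 1, so that all these sums would be at least K. *)
Lemma finite_of_covers (R : realType) (S : set R) (V : nat -> nat -> set R)
    (u : nat -> nat -> \bar R) (c : R) :
  (forall k i, (0 <= u k i)%E) ->
  (forall k s, S s -> exists i, V k i s) ->
  (forall k i s s', V k i s -> V k i s' -> `|s - s'| <= c / k.+1%:R) ->
  (forall k i s, S s -> V k i s -> (1 <= u k i)%E) ->
  (limn_einf (fun k => \sum_(0 <= i <oo) u k i) < +oo)%E ->
  finite_set S.
Proof.
move=> u0 cov small u1 /limn_einf_lt_pinftyP[K uK].
apply: contrapT => Sinf; have [B' BS KB] := @infinite_set_fset R S K Sinf.
have {}BS s : s \in finmap.enum_fset B' -> S s by move=> sB; exact: BS.
have := finmap.fset_uniq B'; move: KB BS; move: (finmap.enum_fset B') => B KB BS uB.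
(* From scale k0 on, no member of the cover contains two points of B. *)
pose k0 := (\max_(s <- B) \max_(s' <- B) Num.truncn (c / `|s - s'|)%R)%N.
have [k k0k] := uK k0; apply/negP; rewrite -leNgt.
have [f fP] : exists f : R -> nat, forall s, s \in B -> V k (f s) s.
  suff : forall s, exists i, s \in B -> V k i s by move=> /choice[f fP]; exists f.
  move=> s; have [sB|_] := boolP (s \in B); last by exists 0%N.
  by have [i] := cov k s (BS _ sB); exists i.
have finj : {in B &, injective f}.
  move=> s s' sB s'B fss; apply/eqP; apply: contraT => ss'.
  have d0 : 0 < `|s - s'| by rewrite normr_gt0 subr_eq0.
  have := small k (f s) s s' (fP _ sB); rewrite {1}fss => /(_ (fP _ s'B)).
  rewrite leNgt => /negP; case.
  rewrite ltr_pdivrMr ?ltr0n// mulrC -ltr_pdivrMr//.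
  apply: lt_le_trans (truncnS_gt _) _; rewrite ler_nat ltnS.
  apply: leq_trans k0k.
  apply: (leq_trans _ (leq_bigmax_seq s sB isT)).
  exact: (leq_bigmax_seq s' s'B isT).
have := @sum_seq_le_nneseries _ (u k) [seq f s | s <- B] (u0 k).
rewrite map_inj_in_uniq// => /(_ uB); apply: le_trans.
rewrite big_map.
apply: (@le_trans _ _ (\sum_(s <- B) 1)%E).
  rewrite sumEFin lee_fin big_const_seq count_predT iter_addr_0 -mulr_natl mulr1.
  by rewrite ler_nat.
rewrite big_seq [leRHS]big_seq; apply: lee_sum => s sB.
by apply: u1 (fP _ sB); exact: BS.
Qed.

(** * Slices of sets of sigma-finite Hausdorff measure *)

Lemma normr_coord_le_enorm (R : realType) (d : nat) (x : 'rV[R]_d) (i : 'I_d) :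
  `|x ord0 i| <= enorm x.
Proof.
rewrite -sqrtr_sqr /enorm ler_sqrt ?sumr_ge0// => [|j _]; last exact: sqr_ge0.
by rewrite (bigD1 i)//= lerDl sumr_ge0// => j _; exact: sqr_ge0.
Qed.

(** A crude bound for the operator norm of x |-> x *m A. *)
Definition mxbound (R : realType) (p q : nat) (A : 'M[R]_(p, q)) : R :=
  \sum_i \sum_j `|A i j|.

Lemma mxbound_ge0 (R : realType) (p q : nat) (A : 'M[R]_(p, q)) : 0 <= mxbound A.
Proof. by rewrite sumr_ge0// => i _; rewrite sumr_ge0. Qed.

Lemma normr_mulmx_coord_le (R : realType) (p q : nat) (A : 'M[R]_(p, q))
    (x : 'rV[R]_p) (c : R) (j : 'I_q) : 0 <= c ->
  (forall i, `|x ord0 i| <= c) -> `|(x *m A) ord0 j| <= mxbound A * c.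
Proof.
move=> c0 xc; rewrite mxE; apply: le_trans (ler_norm_sum _ _ _) _.
rewrite /mxbound mulr_suml; apply: ler_sum => i _.
rewrite normrM mulrC; apply: ler_pM => //.
by rewrite (bigD1 j)//= lerDl sumr_ge0.
Qed.

Lemma enorm_ge0 (R : realType) (d : nat) (x : 'rV[R]_d) : 0 <= enorm x.
Proof. exact: sqrtr_ge0. Qed.

Lemma enorm_sub_le_ediam (R : realType) (d : nat) (U : set 'rV[R]_d) x y :
  U x -> U y -> ((enorm (x - y))%:E <= ediam U)%E.
Proof. by move=> Ux Uy; apply: ereal_sup_ubound; right; exists (x, y). Qed.

Lemma ediam_ge0 (R : realType) (d : nat) (U : set 'rV[R]_d) : (0 <= ediam U)%E.
Proof. by apply: ereal_sup_ubound; left. Qed.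

Lemma hausdorff_covers (R : realType) (d m : nat) (A : set 'rV[R]_d) :
  (hausdorff_measure m A < +oo)%E ->
  exists C : R, forall delta, 0 < delta -> exists U : nat -> set 'rV[R]_d,
    [/\ A `<=` \bigcup_i U i, forall i, (ediam (U i) <= delta%:E)%E &
        (\sum_(0 <= i <oo) hausdorff_gauge m (U i) <= C%:E)%E].
Proof.
move=> Aoo; have [C AC] : exists C : R, (hausdorff_measure m A < C%:E)%E.
  case: (hausdorff_measure m A) Aoo => [x _||_] //.
    by exists (x + 1); rewrite lte_fin ltrDl.
  by exists 0; rewrite ltNyr.
exists C => delta d0.
have : (hausdorff_content m delta A < C%:E)%E.
  by apply: le_lt_trans AC; apply: ereal_sup_ubound; exists delta.
by move=> /ereal_inf_lt[_ [U [cov small] <-] /ltW UC]; exists U.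
Qed.

(** Coordinates in a basis whose first vector is the direction of the lines,
    whose second vector spans a plane with it, and whose remaining vectors index
    the parallel planes. *)
Definition coord_row (R : realType) (m : nat) (s tau : R) (z : nat -> R) :
    'rV[R]_m.+2 :=
  \row_i match val i with 0%N => s | 1%N => tau | j.+2 => z j end.

(** Almost all lines meet a set of sigma-finite (m+1)-dimensional measure in a
    countable set (Eilenberg's inequality, in qualitative form).  The covers that
    bound the measure project along the lines to cubes whose volumes have
    bounded sum; for almost every line the number of cubes above it has a
    finite lower limit as the scale decreases, and each piece of the set then has
    finitely many points on that line. *)
Lemma countable_fibres (R : realType) (m : nat) (A : set 'rV[R]_m.+2)
    (B : 'M[R]_m.+2) (x0 : 'rV[R]_m.+2) (e : R) :
  B \in unitmx -> sigma_finite_hausdorff m.+1 A -> 0 < e ->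
  exists z : nat -> R, (forall j, `|z j| < e) /\
    forall D : set R, countable D -> exists tau,
      [/\ `|tau| < e, ~ D tau &
          countable [set s | A (x0 + coord_row m s tau z *m B)]].
Proof.
move=> Bu [F AE FH] e0.
have /choice[C CP] n := hausdorff_covers (FH n).
have /choice[U UP] : forall nk : nat * nat, exists U : nat -> set 'rV[R]_m.+2,
    [/\ F nk.1 `<=` \bigcup_i U i, forall i, (ediam (U i) <= (nk.2.+1%:R^-1)%:E)%E &
        (\sum_(0 <= i <oo) hausdorff_gauge m.+1 (U i) <= (C nk.1)%:E)%E].
  by move=> [n k]; apply: CP; rewrite invr_gt0 ltr0n.
pose L := mxbound (invmx B).
have L0 : 0 <= L by exact: mxbound_ge0.
pose rho n k i := fine (ediam (U (n, k) i)).
have rhoE n k i : ediam (U (n, k) i) = (rho n k i)%:E.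
  rewrite fineK// ge0_fin_numE ?ediam_ge0//.
  by have [_ /(_ i) h _] := UP (n, k); apply: le_lt_trans h (ltry _).
have rho0 n k i : 0 <= rho n k i by rewrite -lee_fin -rhoE ediam_ge0.
have rho_small n k i : rho n k i <= k.+1%:R^-1.
  by rewrite -lee_fin -rhoE; have [] := UP (n, k).
pose pt n k i : 'rV[R]_m.+2 := xget 0 (U (n, k) i).
pose lam (j : 'I_m.+2) (x : 'rV[R]_m.+2) := ((x - x0) *m invmx B) ord0 j.
have lam_lip j x y : `|lam j x - lam j y| <= L * enorm (x - y).
  have -> : lam j x - lam j y = ((x - y) *m invmx B) ord0 j.
    have -> : x - y = (x - x0) - (y - x0) by rewrite opprB addrA subrK.
    by rewrite mulmxBl /lam; move: (_ *m _) (_ *m _) => a b; rewrite !mxE.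
  apply: normr_mulmx_coord_le => [|i]; first exact: enorm_ge0.
  exact: normr_coord_le_enorm.
have lamE j s tau z :
    lam j (x0 + coord_row m s tau z *m B) = coord_row m s tau z ord0 j.
  by rewrite /lam addrAC subrr add0r mulmxK.
have lam_rho n k i j x : U (n, k) i x -> `|lam j x - lam j (pt n k i)| <= L * rho n k i.
  move=> Ux; apply: le_trans (lam_lip _ _ _) _; apply: ler_wpM2l => //.
  rewrite -lee_fin -rhoE; apply: enorm_sub_le_ediam => //.
  by apply: xgetPex; exists x.
(* The weight w drops the empty members of a cover, whose gauge is 0. *)
pose w n k i : R := (U (n, k) i != set0)%:R.
pose r n k i := L * rho n k i.
have r0 n k i : 0 <= r n k i by exact: mulr_ge0.
have w0 n k i : 0 <= w n k i by exact: ler0n.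
have gauge_ge0 n k i : (0 <= hausdorff_gauge m.+1 (U (n, k) i))%E.
  rewrite /hausdorff_gauge; case: ifP => // _; apply: expe_ge0.
  exact: ediam_ge0.
have gaugeE n k i : ((w n k i * (r n k i *+ 2) * (r n k i *+ 2) ^+ m)%:E =
    ((L *+ 2) ^+ m.+1)%:E * hausdorff_gauge m.+1 (U (n, k) i))%E.
  rewrite /hausdorff_gauge /w; case: eqP => [_|_].
    by rewrite !mul0r mule0.
  rewrite rhoE -EFin_expe -EFinM -mulrA -exprS mul1r; congr EFin.
  by rewrite -exprMn /r; congr (_ ^+ _); rewrite -mulrnAl.
have fin0 n : (limn_einf (fun k => \sum_(0 <= i <oo)
    (w n k i * (r n k i *+ 2) * (r n k i *+ 2) ^+ m)%:E) < +oo)%E.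
  apply: (@limn_einf_bounded _ _ ((L *+ 2) ^+ m.+1 * C n)) => k.
  under eq_eseriesr do rewrite gaugeE.
  rewrite nneseriesZl// EFinM; apply: lee_wpmul2l.
    by rewrite lee_fin exprn_ge0// mulrn_wge0.
  by have [] := UP (n, k).
(* First choose the plane, keeping the side along the second coordinate as a
   weight; then choose the line in that plane. *)
have [|//||z [zs zfin]] := @exists_point_liminf_finite R m e e0
  (fun n k i => w n k i * (r n k i *+ 2)) r
  (fun n k i j => lam (inord j.+2) (pt n k i)).
- by move=> n k i; rewrite mulr_ge0// mulrn_wge0.
- exact: fin0.
exists z; split=> // D cD.
have [|||tau [taus nD taufin]] := @exists_section_liminf_finite R
  (fun n k i => w n k i * \prod_(j < m)
      (`|z j - lam (inord j.+2) (pt n k i)| <= r n k i)%R%:R) r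
  (fun n k i => lam (inord 1) (pt n k i)) D e e0 cD => //.
- by move=> n k i; rewrite mulr_ge0// prodr_ge0.
- move=> n; apply: le_lt_trans (zfin n).
  rewrite le_eqVlt; apply/orP; left; apply/eqP.
  congr limn_einf; apply/funext => k; apply: eq_eseriesr => i _.
  by rewrite mulrAC.
exists tau; split=> //.
rewrite (_ : [set s | _] =
    \bigcup_n [set s | F n (x0 + coord_row m s tau z *m B)]); last first.
  by rewrite AE; apply/seteqP; split=> s [n _ h]; exists n.
apply: bigcup_countable => // n _; apply: finite_set_countable.
apply: (@finite_of_covers _ _
  (fun k i => [set s | U (n, k) i (x0 + coord_row m s tau z *m B)])
  (fun k i => (w n k i * \prod_(j < m)
      (`|z j - lam (inord j.+2) (pt n k i)| <= r n k i)%R%:R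
      * (`|tau - lam (inord 1) (pt n k i)| <= r n k i)%R%:R)%:E) L) => //.
- by move=> k i; rewrite lee_fin mulr_ge0// mulr_ge0// prodr_ge0.
- by move=> k s Fs; have [/(_ _ Fs)[i _ h] _ _] := UP (n, k); exists i.
- move=> k i s s' /= Us Us'.
  have := lam_lip ord0 (x0 + coord_row m s tau z *m B) (x0 + coord_row m s' tau z *m B).
  rewrite !lamE !mxE/= => /le_trans; apply; apply: ler_wpM2l => //.
  apply: le_trans (rho_small n k i).
  by rewrite -lee_fin -rhoE; exact: enorm_sub_le_ediam.
- move=> k i s _ /= Us; rewrite lee_fin.
  have := fun j => lam_rho n k i j _ Us; rewrite -/(r n k i) => lr.
  have -> : w n k i = 1.
    by rewrite /w; case: eqP => // U0; move: Us; rewrite U0.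
  rewrite big1 => [|j _].
    by have := lr (inord 1); rewrite lamE mxE /= inordK// => ->; rewrite !mulr1.
  have := lr (inord j.+2); rewrite lamE mxE /= inordK//; last by rewrite !ltnS.
  by move=> ->.
Qed.

(** * Convexity along a direction and contact points *)

(** Vectors of any length are allowed, 0 included, so that the set of such v can
    be a linear subspace. *)
Definition convex_along (R : realType) (d : nat) (f : 'rV[R]_d -> R)
    (v : 'rV[R]_d) : Prop :=
  forall x a b t, 0 <= t <= 1 ->
    f (x + ((1 - t) * a + t * b) *: v) <=
      (1 - t) * f (x + a *: v) + t * f (x + b *: v).

(** The maximum on the left is strict, which is what prevents midpoint convexity
    at t even when the maximum is attained on an interval. *)
Lemma leftmost_max (R : realType) (g : R -> R) (a b : R) :
  continuous g -> a <= b -> exists t, [/\ a <= t <= b,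
    forall s, a <= s <= b -> g s <= g t &
    forall s, a <= s -> s < t -> g s < g t].
Proof.
move=> cg ab.
have [m mI mmax] := EVT_max ab (continuous_subspaceT cg).
pose K : set R := `[a, b]%classic `&` (g @^-1` [set g m]).
have K0 : K !=set0 by exists m; split.
have cK : compact K.
  apply: compact_closedI; first exact: segment_compact.
  apply: closed_comp => [x _|]; first exact: cg.
  exact: closed_eq.
have cid : continuous (@id R) by move=> x; exact: cvg_id.
have [t /set_mem[tI tm] tmin] :=
  compact_EVT_min K0 cK (continuous_subspaceT cid).
exists t; move: tI; rewrite /= in_itv/= => tI; split => //.
  by move=> s sI; rewrite tm; apply: mmax; rewrite in_itv.
move=> s as_ st; have sI : s \in `[a, b].
  by rewrite in_itv/= as_ /=; case/andP: tI => _; apply: le_trans; exact: ltW.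
rewrite lt_neqAle tm mmax// andbT; apply/eqP => gs.
have sK : s \in K by apply/mem_set; split.
by have := tmin s sK; rewrite leNgt/= st.
Qed.

Lemma continuous_line (R : realType) (d : nat) (y v : 'rV[R]_d) :
  continuous (fun s : R => y + s *: v).
Proof.
move=> s; apply: cvgD; first exact: cvg_cst.
by apply: cvgZr_tmp; exact: cvg_id.
Qed.

Lemma convex_functionE (R : realType) (d : nat) (V : set 'rV[R]_d)
    (f : 'rV[R]_d -> R) : convex_function V f ->
  forall t x y, 0 <= t <= 1 -> V x -> V y ->
    f ((1 - t) *: x + t *: y) <= (1 - t) * f x + t * f y.
Proof.
move=> Vf t x y /andP[t0 t1] Vx Vy; rewrite addrC [leRHS]addrC.
exact: (Vf (Itv01 t0 t1) y x (mem_set Vy) (mem_set Vx)).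
Qed.

(** A locally convex function cannot have a maximum point that is strict on one
    side, so the leftmost maximum of f - c s has to be a point of M. *)
Lemma line_contact (R : realType) (d : nat) (M : set 'rV[R]_d)
    (f : 'rV[R]_d -> R) (y v : 'rV[R]_d) (a b c s0 : R) :
  continuous f -> locally_convex_on (~` M) f -> a < s0 < b ->
  f (y + a *: v) - c * a < f (y + s0 *: v) - c * s0 ->
  f (y + b *: v) - c * b < f (y + s0 *: v) - c * s0 ->
  exists t, [/\ a < t < b, M (y + t *: v) & forall s, a <= s <= b ->
    f (y + s *: v) - c * s <= f (y + t *: v) - c * t].
Proof.
move=> cf lc /andP[as0 s0b] ha hb.
pose g s := f (y + s *: v) - c * s.
have cl := @continuous_line R d y v.
have cg : continuous g.
  move=> s; apply: cvgB; first by apply: continuous_comp; [exact: cl|exact: cf].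
  by apply: cvgMl_tmp; exact: cvg_id.
have [t [/andP[at_ tb] tmax tleft]] := leftmost_max cg (ltW (lt_trans as0 s0b)).
have gs0 : g s0 <= g t by apply: tmax; rewrite !ltW.
have a_t : a < t.
  rewrite lt_neqAle at_ andbT; apply/eqP => E; move: gs0.
  by rewrite -E leNgt ha.
have t_b : t < b.
  rewrite lt_neqAle tb andbT; apply/eqP => E; move: gs0.
  by rewrite E leNgt hb.
exists t; split => //; first by rewrite a_t.
apply: contrapT => nM; have [V [oV Vt _ _ Vconv]] := lc _ nM.
have : \forall s \near t, V (y + s *: v) by apply: (cl t); exact: open_nbhs_nbhs.
move=> /nbhs_ballP[eta /= eta0 etaV].
pose h := Num.min (eta / 2) (Num.min (t - a) (b - t)).
have h0 : 0 < h by rewrite !lt_min divr_gt0//= !subr_gt0 a_t.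
have hta : h <= t - a by rewrite !ge_min lexx orbT.
have hbt : h <= b - t by rewrite !ge_min lexx !orbT.
have heta : h < eta.
  apply: (@le_lt_trans _ _ (eta / 2)); first by rewrite ge_min lexx.
  by rewrite ltr_pdivrMr//; lra.
have Vm : V (y + (t - h) *: v).
  by apply: etaV; rewrite /ball/= opprB addrC subrK gtr0_norm.
have Vp : V (y + (t + h) *: v).
  by apply: etaV; rewrite /ball/= opprD addrA subrr add0r normrN gtr0_norm.
have half : 0 <= (2^-1 : R) <= 1 by rewrite invr_ge0 invf_le1// ler0n ler1n.
have := convex_functionE Vconv half Vm Vp.
have -> : (1 - 2^-1) *: (y + (t - h) *: v) + 2^-1 *: (y + (t + h) *: v) = y + t *: v.
  rewrite !scalerDr !scalerA addrACA -!scalerDl.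
  have -> : 1 - 2^-1 + 2^-1 = 1 :> R by field.
  have -> : (1 - 2^-1) * (t - h) + 2^-1 * (t + h) = t by field.
  by rewrite scale1r.
have lm : g (t - h) < g t by clear -tleft h0 hta; apply: tleft; lra.
have lp : g (t + h) <= g t by clear -tmax h0 at_ hbt; apply: tmax; lra.
move: lm lp; rewrite /g; clear; lra.
Qed.

Lemma convex_along_convex_function (R : realType) (d : nat) (f : 'rV[R]_d -> R) :
  (forall v, convex_along f v) -> convex_function [set: 'rV[R]_d] f.
Proof.
move=> fc t x y _ _; have := fc (y - x) x 0 1 (1 - t%:num) _.
have -> : 1 - (1 - t%:num) = t%:num by lra.
rewrite mulr0 mulr1 add0r scale0r addr0 scale1r subrKC.
have E (c : R) (p q : 'rV[R]_d) : p + (1 - c) *: (q - p) = c *: p + (1 - c) *: q.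
  by rewrite scalerBr addrCA [in p - _]scalerBl scale1r subKr addrC.
have t0 : 0 <= t%:num by [].
have t1 : t%:num <= 1 by [].
by rewrite E; apply; apply/andP; split; lra.
Qed.

Lemma convex_along_scale (R : realType) (d : nat) (f : 'rV[R]_d -> R) c v :
  convex_along f v -> convex_along f (c *: v).
Proof.
move=> fv x a b t t01; have := fv x (a * c) (b * c) t t01.
have -> : (1 - t) * (a * c) + t * (b * c) = ((1 - t) * a + t * b) * c by ring.
by rewrite !scalerA.
Qed.

Lemma convex_along0 (R : realType) (d : nat) (f : 'rV[R]_d -> R) :
  convex_along f 0.
Proof. by move=> x a b t _; rewrite !scaler0 -mulrDl subrK mul1r. Qed.

Lemma normr_le_enorm (R : realType) (d : nat) (x : 'rV[R]_d) : `|x| <= enorm x.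
Proof.
rewrite [leLHS]mx_normrE; apply: bigmax_le => [|[i j] _]/=; first exact: enorm_ge0.
by rewrite (ord1 i); exact: normr_coord_le_enorm.
Qed.

Lemma thin_convex_along (R : realType) (d : nat) (M : set 'rV[R]_d)
    (f : 'rV[R]_d -> R) (v : 'rV[R]_d) :
  continuous f -> locally_convex_on (~` M) f -> intervally_thin M v ->
  convex_along f v.
Proof.
move=> cf lc thin x a b t t01.
rewrite leNgt; apply/negP => viol.
pose X := x + a *: v; pose Y := x + b *: v.
have ZE : x + ((1 - t) * a + t * b) *: v = (1 - t) *: X + t *: Y.
  by rewrite /X /Y !scalerDr !scalerA addrACA -!scalerDl subrK scale1r.
rewrite ZE -/X -/Y in viol.
have near_pt (P : 'rV[R]_d) (eta : R) : 0 < eta ->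
    exists2 e, 0 < e & forall Q, `|Q - P| < e -> `|f Q - f P| < eta.
  move=> eta0; have /cvgrPdist_lt/(_ _ eta0)/nbhs_ballP[e /= e0 eP] := cf P.
  exists e => // Q QP; rewrite distrC; apply: eP.
  by rewrite -ball_normE/= distrC.
pose Z := (1 - t) *: X + t *: Y.
pose eta := (f Z - ((1 - t) * f X + t * f Y)) / 2.
have eta0 : 0 < eta by rewrite divr_gt0// subr_gt0.
(* Moving the three points changes f by less than eta each, hence the
   convexity gap by less than 2 * eta, which is its size. *)
have [eX eX0 PX] := near_pt X _ eta0.
have [eY eY0 PY] := near_pt Y _ eta0.
have [eZ eZ0 PZ] := near_pt Z _ eta0.
pose e := Num.min eX (Num.min eY eZ).
have e0 : 0 < e by rewrite !lt_min eX0 eY0.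
have eeX : e <= eX by rewrite ge_min lexx.
have eeY : e <= eY by rewrite !ge_min lexx orbT.
have eeZ : e <= eZ by rewrite !ge_min lexx !orbT.
have XY : exists r : R, X - Y = r *: v.
  by exists (a - b); rewrite /X /Y opprD addrACA subrr add0r scalerBl.
have [X' [Y' [/= X'X Y'Y XYM]]] := thin X Y XY e e0.
have {}X'X := le_lt_trans (normr_le_enorm _) X'X.
have {}Y'Y := le_lt_trans (normr_le_enorm _) Y'Y.
pose Z' := (1 - t) *: X' + t *: Y'.
have /andP[t0 t1] := t01.
have Z'Z : `|Z' - Z| < e.
  have -> : Z' - Z = (1 - t) *: (X' - X) + t *: (Y' - Y).
    by rewrite /Z' /Z opprD addrACA -!scalerBr.
  apply: le_lt_trans (ler_normD _ _) _.
  rewrite !normrZ (ger0_norm t0) ger0_norm ?subr_ge0//.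
  have [th|th] := lerP t (1 / 2).
    have : (1 / 2) * (e - `|X' - X|) <= (1 - t) * (e - `|X' - X|).
      by clear -th X'X; apply: ler_wpM2r; lra.
    have : 0 <= t * (e - `|Y' - Y|) by rewrite mulr_ge0// subr_ge0 ltW.
    by clear -X'X; lra.
  have : (1 / 2) * (e - `|Y' - Y|) <= t * (e - `|Y' - Y|).
    by clear -th Y'Y; apply: ler_wpM2r; lra.
  have : 0 <= (1 - t) * (e - `|X' - X|) by rewrite mulr_ge0 ?subr_ge0// ltW.
  by clear -Y'Y; lra.
have Z'E s : X' + s *: (Y' - X') = (1 - s) *: X' + s *: Y'.
  by rewrite scalerBr addrCA addrC scalerBl scale1r addrAC.
have : f Z' <= (1 - t) * f X' + t * f Y'.
  rewrite leNgt; apply/negP => viol'.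
  have [tE|tn0] := eqVneq t 0.
    by move: viol'; rewrite /Z' tE subr0 !scale0r !scale1r addr0 mul0r mul1r addr0 ltxx.
  have [tE|tn1] := eqVneq t 1.
    by move: viol'; rewrite /Z' tE subrr !scale0r !scale1r add0r mul0r mul1r add0r ltxx.
  have [|||s [/andP[s0 s1] Ms _]] := @line_contact R d M f X' (Y' - X') 0 1
    (f Y' - f X') t cf lc.
  - by rewrite !lt_neqAle eq_sym tn0 t0 tn1.
  - rewrite (Z'E t) -/Z' scale0r addr0; clear -viol'; lra.
  - rewrite (Z'E t) -/Z' scale1r subrKC; clear -viol'; lra.
  move: XYM; rewrite -subset0 => /(_ (X' + s *: (Y' - X'))); apply; split => //.
  by rewrite Z'E; exists s => //=; rewrite (ltW s0) (ltW s1).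
have := PX X' (lt_le_trans X'X eeX); have := PY Y' (lt_le_trans Y'Y eeY).
have := PZ Z' (lt_le_trans Z'Z eeZ).
rewrite !ltr_norml => /andP[z1 _] /andP[_ y2] /andP[_ x2].
have : 2 * eta = f Z - ((1 - t) * f X + t * f Y) by rewrite /eta; field.
by clear -t0 t1 z1 y2 x2; nra.
Qed.

(** * Countability of the set of kinks *)

Lemma countable_setU (T : Type) (A B : set T) :
  countable A -> countable B -> countable (A `|` B).
Proof.
move=> cA cB; rewrite -bigcup2E; apply: bigcup_countable => // -[|[|i]] _ //=.
Qed.

Lemma countable_inj_int (R : realType) (A : set R) (g : R -> int) :
  {in A &, injective g} -> countable A.
Proof.
move=> gi; apply/countable_injP; exists (fun x => pickle (g x)).
by move=> x y xA yA /(pcan_inj pickleK) /gi; apply.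
Qed.

Lemma countable_subset1 (R : realType) (A : set R) :
  (forall x y, A x -> A y -> x = y) -> countable A.
Proof.
move=> A1; apply: (@countable_inj_int _ _ (fun=> 0)) => x y /set_mem Ax /set_mem Ay _.
exact: A1.
Qed.

(** Assign to a point of E the supremum of the slopes of the chords of G that end
    there.  It grows by at least delta from one point of E to any later one, so
    its quotient by delta has a different integer part at each point of E that
    lies between two others. *)
Lemma slope_gap_countable (R : realType) (E : set R) (G : R -> R) (delta : R) :
  0 < delta ->
  (forall x y z, E x -> E y -> E z -> x < y -> y < z ->
     (G y - G x) / (y - x) + delta <= (G z - G y) / (z - y)) ->
  countable E.
Proof.
move=> d0 gap; pose slope x y := (G y - G x) / (y - x).
pose I := [set y | E y /\ (exists2 x, E x & x < y) /\ (exists2 z, E z & y < z)].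
pose L y := [set slope x y | x in [set x | E x /\ x < y]].
have supL y : I y -> has_sup (L y).
  move=> [Ey [[x Ex xy] [z Ez yz]]]; split.
    by exists (slope x y); exists x.
  exists (slope y z) => _ [x' [Ex' x'y] <-].
  have := gap x' y z Ex' Ey Ez x'y yz.
  rewrite -/(slope _ _) -/(slope _ _); clear -d0; lra.
have step y y' : I y -> I y' -> y < y' -> sup (L y) + delta <= sup (L y').
  move=> Iy Iy' yy'; have [Ey _] := Iy; have [Ey' _] := Iy'.
  have yy'L : slope y y' <= sup (L y').
    by apply: ub_le_sup; [have [] := supL _ Iy'|exists y].
  suff : sup (L y) <= slope y y' - delta by lra.
  apply: ge_sup; first by have [] := supL _ Iy.
  move=> _ [x [Ex xy] <-].
  have := gap x y y' Ex Ey Ey' xy yy'.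
  rewrite -/(slope _ _) -/(slope _ _); clear -d0; lra.
have floor_lt y y' : I y -> I y' -> y < y' ->
    Num.floor (sup (L y) / delta) != Num.floor (sup (L y') / delta).
  move=> Iy Iy' yy'; apply/eqP => fE.
  have /andP[lo _] := floor_itv (sup (L y) / delta).
  have /andP[_ hi] := floor_itv (sup (L y') / delta).
  have : sup (L y) / delta + 1 <= sup (L y') / delta.
    rewrite -(divff (lt0r_neq0 d0)) -mulrDl ler_pM2r ?invr_gt0//.
    exact: step.
  by move: lo hi; rewrite fE intrD; lra.
have cI : countable I.
  apply: (@countable_inj_int _ _ (fun y => Num.floor (sup (L y) / delta))).
  move=> y y' /set_mem Iy /set_mem Iy' /eqP fE; apply/eqP.
  rewrite eq_le !leNgt; apply/andP; split; apply/negP => lt.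
    by move: fE; rewrite eq_sym (negbTE (floor_lt _ _ Iy' Iy lt)).
  by move: fE; rewrite (negbTE (floor_lt _ _ Iy Iy' lt)).
(* The first and the last point of E, if any, were left out of I. *)
pose mn := [set y | E y /\ forall x, E x -> y <= x].
pose mx := [set y | E y /\ forall x, E x -> x <= y].
have cmn : countable mn.
  by apply: countable_subset1 => x y [Ex xm] [Ey ym]; apply/eqP; rewrite eq_le xm// ym.
have cmx : countable mx.
  by apply: countable_subset1 => x y [Ex xm] [Ey ym]; apply/eqP; rewrite eq_le ym// xm.
apply: (@sub_countable _ _ _ (I `|` (mn `|` mx))); last first.
  by apply: countable_setU => //; exact: countable_setU.
apply: subset_card_le => y Ey.
have [[x Ex xy]|nomin] := pselect (exists2 x, E x & x < y); last first.
  right; left; split => // x Ex; rewrite leNgt; apply/negP => xy.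
  by apply: nomin; exists x.
have [[z Ez yz]|nomax] := pselect (exists2 z, E z & y < z); last first.
  right; right; split => // z Ez; rewrite leNgt; apply/negP => yz.
  by apply: nomax; exists z.
by left; split => //; split; [exists x|exists z].
Qed.

(** The shear argument.  Phi is convex in the directions (1, 0) and (-1, 1), and at
    the lines x and z it lies below a wedge of opening delta with apex at h x,
    respectively h z.  Going from y to the line x, the two directions arrive at
    heights h y and h y + (y - x); whatever h x is, the distances of these heights
    to h x add up to at least y - x, so the wedge costs at least
    delta * (y - x) in total, and similarly for z. *)
Lemma kink_slope_gap (R : realType) (Phi : R -> R -> R) (h : R -> R)
    (delta x y z a b : R) :
  0 < delta -> x < y -> y < z ->
  (forall s, (z - x) * Phi y s <= (z - y) * Phi x s + (y - x) * Phi z s) ->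
  (forall s, (z - x) * Phi y s <=
     (z - y) * Phi x (s + (y - x)) + (y - x) * Phi z (s - (z - y))) ->
  (forall s, a <= s <= b -> Phi x s <= Phi x (h x) - delta * `|s - h x|) ->
  (forall s, a <= s <= b -> Phi z s <= Phi z (h z) - delta * `|s - h z|) ->
  a <= h y <= b -> a <= h y - (z - y) -> h y + (y - x) <= b ->
  (Phi y (h y) - Phi x (h x)) / (y - x) + delta <=
    (Phi z (h z) - Phi y (h y)) / (z - y).
Proof.
move=> d0 xy yz cvx1 cvx2 kx kz /andP[ah hb] ah' hb'.
have r0 : 0 < y - x by rewrite subr_gt0.
have r0' : 0 < z - y by rewrite subr_gt0.
set r := y - x in r0 hb' cvx1 cvx2 *; set r' := z - y in r0' ah' cvx1 cvx2 *.
have zx : z - x = r + r' by rewrite /r /r'; ring.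
rewrite zx in cvx1 cvx2.
have := cvx1 (h y); have := cvx2 (h y).
have := kx (h y); rewrite ah hb => /(_ isT).
have := kx (h y + r); rewrite hb' (le_trans ah) ?lerDl ?(ltW r0)// => /(_ isT).
have := kz (h y); rewrite ah hb => /(_ isT).
have := kz (h y - r'); rewrite ah' (le_trans _ hb) ?gerBl ?(ltW r0')// => /(_ isT).
have A1 : r <= `|h y - h x| + `|h y + r - h x|.
  rewrite addrC -(distrC (h x) (h y)); apply: le_trans (ler_normD _ _).
  by clear; apply: le_trans (ler_norm _); lra.
have A2 : r' <= `|h y - h z| + `|h y - r' - h z|.
  rewrite -(distrC (h z) (h y - r')); apply: le_trans (ler_normD _ _).
  by clear; apply: le_trans (ler_norm _); lra.
move: A1 A2; move: `|h y - h x| `|h y + r - h x| `|h y - h z| `|h y - r' - h z|.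
move: (Phi x (h y)) (Phi x (h y + r)) (Phi z (h y)) (Phi z (h y - r')).
move: (Phi x (h x)) (Phi y (h y)) (Phi z (h z)).
move=> X Y Z P1 P2 P3 P4 m1 m2 m3 m4 A1 A2 K4 K3 K2 K1 C2 C1.
rewrite -lerBrDl; rewrite -(@ler_pM2l _ (r * r')) ?mulr_gt0//.
have -> : r * r' * ((Z - Y) / r' - (Y - X) / r) = r * (Z - Y) - r' * (Y - X).
  by field; rewrite !gt_eqF.
have B1 : r' * P1 + r' * P2 <= r' * (2 * X - delta * r).
  rewrite -mulrDr; apply: ler_wpM2l; first exact: ltW.
  have : delta * r <= delta * (m1 + m2) by apply: ler_wpM2l => //; exact: ltW.
  by clear -K1 K2 A1; lra.
have B2 : r * P3 + r * P4 <= r * (2 * Z - delta * r').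
  rewrite -mulrDr; apply: ler_wpM2l; first exact: ltW.
  have : delta * r' <= delta * (m3 + m4) by apply: ler_wpM2l => //; exact: ltW.
  by clear -K3 K4 A2; lra.
by clear -C1 C2 B1 B2; nra.
Qed.

(** * Sums of directions of convexity *)

(** Where convexity fails, some chord slope to the left exceeds the chord slope to
    the right; the slopes strictly between c1 and c2 then all have interior
    maxima.  The strict inequalities persist on nearby lines. *)
Lemma concave_chord_lt (R : realType) (g : R -> R) (a b t : R) : a < b ->
  0 <= t <= 1 -> (1 - t) * g a + t * g b < g ((1 - t) * a + t * b) ->
  exists a' s b' c1 c2, [/\ a' < s, s < b', c1 < c2,
    g b' - g s < c1 * (b' - s) & c2 * (s - a') < g s - g a'].
Proof.
move=> ab /andP[t0 t1] viol; set s := (1 - t) * a + t * b in viol.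
have tpos : 0 < t.
  rewrite lt_neqAle eq_sym t0 andbT; apply/eqP => tE; move: viol.
  by rewrite /s tE subr0 !mul1r !mul0r !addr0 ltxx.
have tlt1 : t < 1.
  rewrite lt_neqAle t1 andbT; apply/eqP => tE; move: viol.
  by rewrite /s tE subrr !mul1r !mul0r !add0r ltxx.
have sa : s - a = t * (b - a) by rewrite /s; ring.
have bs : b - s = (1 - t) * (b - a) by rewrite /s; ring.
have sa0 : 0 < s - a by rewrite sa mulr_gt0 ?subr_gt0.
have bs0 : 0 < b - s by rewrite bs mulr_gt0 ?subr_gt0.
pose rt := (g b - g s) / (b - s); pose lt := (g s - g a) / (s - a).
have rtlt : rt < lt.
  rewrite /rt /lt ltr_pdivrMr// mulrAC ltr_pdivlMr// sa bs.
  have -> : (g b - g s) * (t * (b - a)) = (b - a) * (t * g b - t * g s) by ring.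
  have -> : (g s - g a) * ((1 - t) * (b - a)) =
    (b - a) * ((1 - t) * g s - (1 - t) * g a) by ring.
  by rewrite ltr_pM2l ?subr_gt0//; lra.
exists a, s, b, (rt + (lt - rt) / 3), (lt - (lt - rt) / 3); split.
- by rewrite -subr_gt0.
- by rewrite -subr_gt0.
- lra.
- by rewrite -ltr_pdivrMr// -/rt; lra.
- by rewrite -ltr_pdivlMr// -/lt; lra.
Qed.

Lemma concave_chord (R : realType) (g : R -> R) (a b t : R) :
  0 <= t <= 1 -> (1 - t) * g a + t * g b < g ((1 - t) * a + t * b) ->
  exists a' s b' c1 c2, [/\ a' < s, s < b', c1 < c2,
    g b' - g s < c1 * (b' - s) & c2 * (s - a') < g s - g a'].
Proof.
move=> t01 viol; case: (ltgtP a b) => [ab|ba|ab].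
- exact: concave_chord_lt viol.
- apply: (@concave_chord_lt R g b a (1 - t)) => //.
    by move: t01; lra.
  by rewrite subKr addrC [X in _ < g X]addrC.
- by move: viol; rewrite ab -!mulrDl subrK !mul1r ltxx.
Qed.

Lemma near_secant (R : realType) (d : nat) (f : 'rV[R]_d -> R)
    (v x0 : 'rV[R]_d) (s a c : R) : continuous f ->
  c * (s - a) < f (x0 + s *: v) - f (x0 + a *: v) ->
  exists2 delta, 0 < delta & forall x a', `|x - x0| < delta -> `|a' - a| < delta ->
    c * (s - a') < f (x + s *: v) - f (x + a' *: v).
Proof.
move=> cf lt.
pose psi (p : 'rV[R]_d * R) := f (p.1 + s *: v) - f (p.1 + p.2 *: v) - c * (s - p.2).
have cpsi : psi p @[p --> (x0, a)] --> psi (x0, a).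
  apply: cvgB; first apply: cvgB.
  - apply: (@cvg_comp _ _ _ (fun p : 'rV[R]_d * R => p.1 + s *: v) f); last exact: cf.
    by apply: cvgD; [exact: cvg_fst|exact: cvg_cst].
  - apply: (@cvg_comp _ _ _ (fun p : 'rV[R]_d * R => p.1 + p.2 *: v) f); last exact: cf.
    by apply: cvgD; [exact: cvg_fst|apply: cvgZr_tmp; exact: cvg_snd].
  - by apply: cvgMl_tmp; apply: cvgB; [exact: cvg_cst|exact: cvg_snd].
have psi0 : 0 < psi (x0, a) by rewrite /psi/= subr_gt0.
have : nbhs (x0, a) [set p | 0 < psi p] by exact: (cvgr_gt _ cpsi _ psi0).
move=> /nbhs_ballP[delta /= delta0 dP].
exists delta => // x a' xd ad.
have := dP (x, a'); rewrite /psi/= subr_gt0; apply; split => /=.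
  by rewrite -ball_normE/= distrC.
by rewrite -ball_normE/= distrC.
Qed.

Lemma convex_along_weights (R : realType) (d : nat) (f : 'rV[R]_d -> R)
    (v x : 'rV[R]_d) (p q a b c : R) : convex_along f v ->
  0 < p -> 0 < q -> (p + q) * c = p * a + q * b ->
  (p + q) * f (x + c *: v) <= p * f (x + a *: v) + q * f (x + b *: v).
Proof.
move=> fv p0 q0 cE; have pq0 : 0 < p + q by rewrite addr_gt0.
pose t := q / (p + q).
have t01 : 0 <= t <= 1.
  apply/andP; split; first by rewrite divr_ge0// ltW.
  by rewrite /t ler_pdivrMr// mul1r lerDr ltW.
have tp : (p + q) * (1 - t) = p by rewrite /t; field; rewrite gt_eqF.
have tq : (p + q) * t = q by rewrite /t; field; rewrite gt_eqF.
have combE A B : (p + q) * ((1 - t) * A + t * B) = p * A + q * B.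
  by rewrite -[X in _ = X * A + _]tp -[X in _ = _ + X * B]tq; ring.
have := fv x a b t t01; rewrite -(ler_pM2l pq0) combE.
suff -> : (1 - t) * a + t * b = c by [].
by apply: (mulfI (lt0r_neq0 pq0)); rewrite cE combE.
Qed.

Lemma complete_basis (R : realType) (m : nat) (v w : 'rV[R]_m.+2) :
  (forall a b : R, a *: v + b *: w = 0 -> a = 0 /\ b = 0) ->
  exists2 B : 'M[R]_m.+2, B \in unitmx &
    forall s tau, coord_row m s tau (fun=> 0) *m B = s *: v + tau *: w.
Proof.
move=> indep; pose A : 'M[R]_(1 + 1, 2 + m) := col_mx v w.
have combE (s t : R) : row_mx s%:M t%:M *m A = s *: (v : 'rV_(2 + m)) + t *: w.
  by rewrite mul_row_col !mul_scalar_mx.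
have Afree : row_free A.
  apply: inj_row_free => x; rewrite -[x]hsubmxK.
  rewrite [lsubmx x]mx11_scalar [rsubmx x]mx11_scalar.
  rewrite combE => /indep[-> ->].
  by rewrite raddf0 row_mx0.
pose L : 'M[R]_(1 + 1 + m) := block_mx (col_ebase A) 0 0 1%:M.
have Lunit : L \in unitmx.
  by rewrite unitmxE det_ublock det1 mulr1 -unitmxE col_ebase_unit.
pose B : 'M[R]_(1 + 1 + m) := L *m (row_ebase A : 'M[R]_(1 + 1 + m)).
exists B; first by rewrite unitmx_mul Lunit row_ebase_unit.
move=> s tau; rewrite -combE -[in RHS](mulmx_ebase A) (eqP Afree) pid_mx_row.
have -> : coord_row m s tau (fun=> 0) = row_mx (row_mx s%:M tau%:M) 0 :> 'rV_(2 + m).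
  apply/rowP => i; rewrite !mxE; case: splitP => j jE; rewrite mxE.
    case: splitP => k kE; rewrite mxE (ord1 k) /= jE kE (ord1 k)/=.
      by [].
    by [].
  by rewrite /= jE.
rewrite /B !mulmxA; congr (_ *m _).
apply: (etrans (@mul_row_block R 1 (1 + 1) m (1 + 1) m _ _ _ _ _ _)).
by rewrite !mulmx0 mul0mx !addr0 mul_mx_row mulmx1 mulmx0.
Qed.

Lemma coord_row_split (R : realType) (m : nat) (s tau : R) (z : nat -> R) :
  coord_row m s tau z = coord_row m 0 0 z + coord_row m s tau (fun=> 0).
Proof.
by apply/rowP => i; rewrite !mxE; case: (val i) => [|[|j]]; rewrite ?add0r ?addr0.
Qed.

Lemma uncountable_itv (R : realType) (a b : R) : a < b ->
  ~ countable (`]a, b[%classic : set R).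
Proof.
move=> ab /countable_lebesgue_measure0 m0.
have := lebesgue_measure_itv `]a, b[; rewrite m0 /= lte_fin ab -EFinB => -[].
by lra.
Qed.

(** The main step, in coordinates where u + w and w are basis vectors. *)
Lemma convex_along_add_indep (R : realType) (m : nat) (M : set 'rV[R]_m.+2)
    (f : 'rV[R]_m.+2 -> R) (u w : 'rV[R]_m.+2) (B : 'M[R]_m.+2) :
  continuous f -> locally_convex_on (~` M) f -> sigma_finite_hausdorff m.+1 M ->
  convex_along f u -> convex_along f w -> B \in unitmx ->
  (forall s tau, coord_row m s tau (fun=> 0) *m B = s *: (u + w) + tau *: w) ->
  convex_along f (u + w).
Proof.
move=> cf lc sM fu fw Bu BE x0 a0 b0 t0 t01; set v := u + w.
rewrite leNgt; apply/negP => viol.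
have [a [s0 [b [c1 [c2 [as0 s0b c12 hb ha]]]]]] :=
  @concave_chord R (fun s => f (x0 + s *: v)) _ _ _ t01 viol.
rewrite /= in ha hb.
(* Both secant inequalities in the same form, so that one lemma makes them
   uniform in the neighbouring lines. *)
have {}hb : c1 * (s0 - b) < f (x0 + s0 *: v) - f (x0 + b *: v).
  by clear -hb; lra.
have [da da0 Pa] := near_secant cf ha.
have [db db0 Pb] := near_secant cf hb.
pose delta := Num.min da db.
have delta0 : 0 < delta by rewrite lt_min da0.
(* Every maximum point stays at distance rho from both ends of [a, b], and the
   lines considered are at mutual distance at most rho, so the sheared heights
   remain in [a, b]. *)
pose rho := Num.min (delta / 2) (Num.min (s0 - a) (b - s0)).
have rho0 : 0 < rho by rewrite !lt_min divr_gt0//= !subr_gt0 as0.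
have rho_delta : rho < delta.
  by apply: (@le_lt_trans _ _ (delta / 2)); [rewrite ge_min lexx|clear -delta0; lra].
have rho_a : rho <= s0 - a by rewrite !ge_min lexx orbT.
have rho_b : rho <= b - s0 by rewrite !ge_min lexx !orbT.
have del_a : delta <= da by rewrite ge_min lexx.
have del_b : delta <= db by rewrite ge_min lexx orbT.
have L0 := mxbound_ge0 B; set L := mxbound B in L0.
pose e := Num.min (rho / 2) (delta / (L + 1)).
have e0 : 0 < e by rewrite lt_min !divr_gt0//; clear -L0; lra.
have e_rho : 2 * e <= rho.
  have : e <= rho / 2 by rewrite ge_min lexx.
  by lra.
have e_delta : L * e < delta.
  have : e <= delta / (L + 1) by rewrite ge_min lexx orbT.
  by clear -L0 e0; rewrite ler_pdivlMr; nra.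
have [z [zs good]] := countable_fibres x0 Bu sM e0.
pose Y := x0 + coord_row m 0 0 z *m B.
have lineE s tau : x0 + coord_row m s tau z *m B = Y + tau *: w + s *: v.
  by rewrite coord_row_split mulmxDl BE -/v [s *: _ + _]addrC !addrA.
pose F tau s := f (Y + tau *: w + s *: v).
have near_x0 tau : `|tau| < e -> `|Y + tau *: w - x0| < delta.
  move=> taue; have := lineE 0 tau; rewrite scale0r addr0 => <-.
  rewrite addrAC subrr add0r; apply: le_lt_trans e_delta.
  rewrite [leLHS]mx_normrE; apply: bigmax_le => [|[i j] _]/=.
    by rewrite mulr_ge0// ltW.
  rewrite (ord1 i); apply: normr_mulmx_coord_le; first exact: ltW.
  move=> k; rewrite mxE; case: (val k) => [|[|l]]; rewrite ?normr0; last 1 first.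
  - exact: ltW.
  - exact: ltW.
  - exact: ltW.
have contact_inner tau c t : `|tau| < e -> c1 <= c <= c2 -> a < t < b ->
    (forall s, a <= s <= b -> F tau s - c * s <= F tau t - c * t) ->
    a + rho <= t /\ t <= b - rho.
  move=> taue /andP[c1c cc2] /andP[at_ tb] tmax.
  have := tmax s0; rewrite (ltW as0) (ltW s0b) => /(_ isT) s0t.
  split; rewrite leNgt; apply/negP => tlt.
    have h : c2 * (s0 - t) < F tau s0 - F tau t.
      apply: Pa; first exact: lt_le_trans (near_x0 _ taue) del_a.
      by rewrite gtr0_norm ?subr_gt0//; clear -tlt rho_delta del_a; lra.
    have : c * (s0 - t) <= c2 * (s0 - t).
      by apply: ler_wpM2r => //; clear -tlt rho_a; lra.
    by clear -h s0t; lra.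
  have h : c1 * (s0 - t) < F tau s0 - F tau t.
    apply: Pb; first exact: lt_le_trans (near_x0 _ taue) del_b.
    by rewrite ltr0_norm ?subr_lt0//; clear -tlt rho_delta del_b; lra.
  have : c * (s0 - t) <= c1 * (s0 - t).
    by apply: ler_wnM2r => //; clear -tlt rho_b; lra.
  by clear -h s0t; lra.
(* Lines carrying a concave kink of slopes q' on the left and q on the right;
   each of the two lines of slopes q and q' bounds F on the whole segment. *)
pose E q q' := [set tau | `|tau| < e /\ exists t, [/\ a + rho <= t, t <= b - rho &
  forall s, a <= s <= b ->
    F tau s <= F tau t + q * (s - t) /\ F tau s <= F tau t + q' * (s - t)]].
have cE q q' : q < q' -> countable (E q q').
  move=> qq'.
  have /choice[h hP] : forall tau, exists t, E q q' tau ->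
      [/\ `|tau| < e, a + rho <= t, t <= b - rho & forall s, a <= s <= b ->
        F tau s <= F tau t + q * (s - t) /\ F tau s <= F tau t + q' * (s - t)].
    move=> tau; have [[taue [t [at_ tb tm]]]|nE] := pselect (E q q' tau).
      by exists t.
    by exists 0.
  (* Subtracting the mean slope makes the kink symmetric. *)
  pose Phi tau s := F tau s - (q + q') / 2 * s.
  have kink tau s : E q q' tau -> a <= s <= b ->
      Phi tau s <= Phi tau (h tau) - (q' - q) / 2 * `|s - h tau|.
    move=> Etau sI; have [_ _ _ /(_ s sI)[]] := hP tau Etau.
    by rewrite /Phi; clear; case: (ger0P (s - h tau)) => _; lra.
  apply: (@slope_gap_countable _ _ (fun tau => Phi tau (h tau)) ((q' - q) / 2)).
    by clear -qq'; lra.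
  move=> x y y' Ex Ey Ey' xy yy'.
  have [xe _ _ _] := hP _ Ex; have [_ hya hyb _] := hP _ Ey.
  have [y'e _ _ _] := hP _ Ey'.
  move: xe y'e; rewrite !ltr_norml => /andP[xe _] /andP[_ y'e].
  apply: (@kink_slope_gap _ Phi h _ x y y' a b) => //.
  - by clear -qq'; lra.
  - move=> s; have xyy' : (y' - y + (y - x)) * y = (y' - y) * x + (y - x) * y' by ring.
    have := @convex_along_weights _ _ f w (Y + s *: v) (y' - y) (y - x) x y' y fw.
    rewrite !subr_gt0 => /(_ yy' xy xyy').
    rewrite ![Y + s *: v + _]addrAC -!/(F _ _) /Phi; clear; lra.
  - move=> s.
    have xyy' : (y' - y + (y - x)) * 0 =
        (y' - y) * (y - x) + (y - x) * - (y' - y) by ring.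
    have := @convex_along_weights _ _ f u (Y + y *: w + s *: v) (y' - y) (y - x)
      (y - x) (- (y' - y)) 0 fu.
    rewrite !subr_gt0 => /(_ yy' xy xyy').
    have -> : Y + y *: w + s *: v + (y - x) *: u = Y + x *: w + (s + (y - x)) *: v.
      by apply/rowP => i; rewrite /v !mxE; ring.
    have -> : Y + y *: w + s *: v + - (y' - y) *: u = Y + y' *: w + (s - (y' - y)) *: v.
      by apply/rowP => i; rewrite /v !mxE; ring.
    rewrite scale0r addr0 -!/(F _ _) /Phi; clear; lra.
  - by move=> s; exact: kink.
  - by move=> s; exact: kink.
  - by clear -hya hyb rho0; lra.
  - by clear -xe y'e xy yy' hya hyb e_rho; lra.
  - by clear -xe y'e xy yy' hya hyb e_rho; lra.
pose D := \bigcup_(p in [set p : rat * rat | p.1 < p.2]) E (ratr p.1) (ratr p.2).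
have cD : countable D.
  apply: bigcup_countable => [|p /= pp]; first exact: countableP.
  by apply: cE; rewrite ltr_rat.
have [tau [taue nD cfib]] := good D cD.
have /choice[T TP] : forall c, exists t, c1 < c < c2 ->
    [/\ a < t < b, M (Y + tau *: w + t *: v) & forall s, a <= s <= b ->
      F tau s - c * s <= F tau t - c * t].
  move=> c; have [/andP[c1c cc2]|_] := boolP (c1 < c < c2); last by exists 0.
  have [|||t [tI Mt tmax]] := @line_contact R _ M f (Y + tau *: w) v a b c s0 cf lc.
  - by rewrite as0.
  - have h : c2 * (s0 - a) < F tau s0 - F tau a.
      apply: Pa; first exact: lt_le_trans (near_x0 _ taue) del_a.
      by rewrite subrr normr0.
    have : c * (s0 - a) <= c2 * (s0 - a).
      by apply: ler_wpM2r; rewrite ?subr_ge0 ltW.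
    by rewrite -!/(F _ _); clear -h; lra.
  - have h : c1 * (s0 - b) < F tau s0 - F tau b.
      apply: Pb; first exact: lt_le_trans (near_x0 _ taue) del_b.
      by rewrite subrr normr0.
    have : c * (s0 - b) <= c1 * (s0 - b).
      by apply: ler_wnM2r; rewrite ?subr_le0 ltW.
    by rewrite -!/(F _ _); clear -h; lra.
  by exists t => _; split.
(* Two slopes with a common maximum point form a kink, and so do rational
   slopes between them, which the choice of tau excludes. *)
have Tne c c' : c1 < c -> c < c' -> c' < c2 -> T c != T c'.
  move=> c1c cc' c'c2; apply/eqP => TT.
  have [q /itvP qI] := rat_in_itvoo cc'.
  have qc' : ratr q < c' by rewrite qI.
  have cq : c < ratr q by rewrite qI.
  have [q' /itvP q'I] := rat_in_itvoo qc'.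
  have q'c' : ratr q' < c' by rewrite q'I.
  have qq' : ratr q < ratr q' :> R by rewrite q'I.
  have [|tI Mt tm] := TP c; first by rewrite c1c (lt_trans cc').
  have [|_ _ tm'] := TP c'; first by rewrite c'c2 (lt_trans c1c).
  apply: nD; exists (q, q') => /=; first by rewrite -(ltr_rat R).
  split=> //; exists (T c).
  have [at_ tb] : a + rho <= T c /\ T c <= b - rho.
    by apply: (@contact_inner tau c) => //; rewrite (ltW c1c) ltW// (lt_trans cc').
  split=> // s sI; have := tm s sI; have := tm' s sI; rewrite -TT.
  have mul_le p p' : p <= p' -> 0 <= s - T c -> p * (s - T c) <= p' * (s - T c).
    by move=> pp' st0; exact: ler_wpM2r.
  have mul_ge p p' : p <= p' -> s - T c <= 0 -> p' * (s - T c) <= p * (s - T c).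
    by move=> pp' st0; exact: ler_wnM2r.
  have [st0|/ltW st0] := lerP 0 (s - T c).
    have := mul_le _ _ (ltW cq) st0; have := mul_le _ _ (ltW qq') st0.
    by clear; split; lra.
  have := mul_ge _ _ (ltW q'c') st0; have := mul_ge _ _ (ltW qq') st0.
  by clear; split; lra.
(* The contact points embed the interval of slopes into the fibre of M. *)
apply: (uncountable_itv c12).
have /countable_injP[phi phiP] := cfib.
apply/countable_injP; exists (phi \o T) => c c' /set_mem cI /set_mem c'I.
rewrite /= !in_itv/= in cI c'I.
have fib x : c1 < x < c2 -> T x \in [set s | M (x0 + coord_row m s tau z *m B)].
  by move=> /TP[_ Mx _]; apply/mem_set; rewrite /= lineE.
move=> /= /(phiP _ _ (fib _ cI) (fib _ c'I)) /eqP TT.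
move: cI c'I => /andP[c1c cc2] /andP[c1c' c'c2].
case: (ltgtP c c') => // lt.
  by move: TT; rewrite (negbTE (Tne c c' c1c lt c'c2)).
by move: TT; rewrite eq_sym (negbTE (Tne c' c c1c' lt cc2)).
Qed.

(** If u and w are dependent, then w vanishes or u + w is a multiple of w;
    otherwise u + w and w extend to a basis. *)
Lemma convex_along_add (R : realType) (m : nat) (M : set 'rV[R]_m.+2)
    (f : 'rV[R]_m.+2 -> R) (u w : 'rV[R]_m.+2) :
  continuous f -> locally_convex_on (~` M) f -> sigma_finite_hausdorff m.+1 M ->
  convex_along f u -> convex_along f w -> convex_along f (u + w).
Proof.
move=> cf lc sM fu fw.
have [w0|wn0] := eqVneq w 0; first by rewrite w0 addr0.
have [[c ucw]|indep] := pselect (exists c, u = c *: w).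
  have -> : u + w = (c + 1) *: w by rewrite scalerDl scale1r ucw.
  exact: convex_along_scale.
have [a b ab0|B Bu BE] := @complete_basis R m (u + w) w.
  have a0 : a = 0.
    apply/eqP; apply: contraPT indep => an0; rewrite not_notE.
    exists (- (a + b) / a); apply: (scalerI an0).
    rewrite scalerA mulrC divfK// scaleNr; apply/eqP; rewrite -addr_eq0.
    by rewrite scalerDl addrA -scalerDr ab0.
  split=> //; move: ab0; rewrite a0 scale0r add0r => /eqP.
  by rewrite scaler_eq0 (negbTE wn0) orbF => /eqP.
exact: convex_along_add_indep lc sM fu fw Bu BE.
Qed.

Theorem theorem1 (R : realType) (d : nat) (d_gt0 : (0 < d)%N)
    (M : set 'rV[R]_d) (n : d.-tuple 'rV[R]_d)
    (n_sphere : forall i : 'I_d, esphere (tnth n i))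
    (n_free : free n)
    (M_compact : compact M)
    (M_thin : forall i : 'I_d, intervally_thin M (tnth n i))
    (M_sigma_finite : sigma_finite_hausdorff d.-1 M) :
  c_removable M.
Proof.
split; first by apply: compact_closed => //; exact: norm_hausdorff.
move=> f cf lc; apply: convex_along_convex_function => v.
have fn i : convex_along f (tnth n i) by apply: thin_convex_along cf lc (M_thin i).
have n_span : <<n>>%VS = fullv.
  apply/eqP; rewrite eqEdim subvf dimvf (eqnP n_free) size_tuple.
  by rewrite /dim/= mul1n.
have -> : v = \sum_i coord n i v *: n`_i.
  by apply: coord_span; rewrite n_span memvf.
case: d d_gt0 M n n_sphere n_free M_compact M_thin M_sigma_finite f cf lc v fn n_span =>
  [//|[|m]] _ M n _ _ _ _ sM f cf lc v fn _.
  by rewrite big_ord1; apply: convex_along_scale; rewrite -(tnth_nth 0).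
apply: (big_ind (convex_along f)).
- exact: convex_along0.
- by move=> u w; exact: convex_along_add lc sM.
- by move=> i _; apply: convex_along_scale; rewrite -(tnth_nth 0).
Qed.
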